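(* Let $X$ be a real Banach space, $I=\{1,\ldots,m\}$, $J=\{1,\ldots,l\}$, let $f_i\colon X\to\mathbb{R}$ ($i\in I$) and $g_j\colon X\to\mathbb{R}$ ($j\in J$) be given, and let $$M=\{x\in X \mid f_i(x)=0\ \forall i\in I,\ g_j(x)\le 0\ \forall j\in J\}.$$ Let $\overline{x}\in M$ and $J(\overline{x})=\{j\in J\mid g_j(\overline{x})=0\}$. Suppose that the functions $f_i$, $i\in I$, are continuous in a neighbourhood of $\overline{x}$; the functions $g_j$, $j\notin J(\overline{x})$, are upper semicontinuous at $\overline{x}$; and the functions $f_i$, $i\in I$, and $g_j$, $j\in J(\overline{x})$, are quasidifferentiable at $\overline{x}$ uniformly along finite dimensional spaces, with given quasidifferentials $[\underline{\partial} f_i(\overline{x}),\overline{\partial} f_i(\overline{x})]$ and $[\underline{\partial} g_j(\overline{x}),\overline{\partial} g_j(\overline{x})]$. Let $x_i^*\in\underline{\partial} f_i(\overline{x})$, $y_i^*\in\overline{\partial} f_i(\overline{x})$, $i\in I$, and $z_j^*\in\overline{\partial} g_j(\overline{x})$, $j\in J(\overline{x})$, be given, and suppose the following constraint qualification holds: (1) for any $i\in I$ there exists $v_i\in X$ such that $s(\underline{\partial} f_i(\overline{x})+y_i^*,v_i)<0$ and for any $k\ne i$ one has $s(\underline{\partial} f_k(\overline{x})+y_k^*,v_i)\le 0$ and $s(-x_k^*-\overline{\partial} f_k(\overline{x}),v_i)\le 0$; (2) for any $i\in I$ there exists $w_i\in X$ such that $s(-x_i^*-\overline{\partial} f_i(\overline{x}),w_i)<0$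 and for any $k\ne i$ one has $s(-x_k^*-\overline{\partial} f_k(\overline{x}),w_i)\le 0$ and $s(\underline{\partial} f_k(\overline{x})+y_k^*,w_i)\le 0$; (3) there exists $v_0\in X$ such that $s(\underline{\partial} g_j(\overline{x})+z_j^*,v_0)<0$ for any $j\in J(\overline{x})$, while for any $i\in I$ one has $s(\underline{\partial} f_i(\overline{x})+y_i^*,v_0)\le 0$ and $s(-x_i^*-\overline{\partial} f_i(\overline{x}),v_0)\le 0$. Then $$\Big\{v\in X \Bigm| s(\underline{\partial} f_i(\overline{x})+y_i^*,v)\le 0,\ s(-x_i^*-\overline{\partial} f_i(\overline{x}),v)\le 0\ \forall i\in I,\ s(\underline{\partial} g_j(\overline{x})+z_j^*,v)\le 0\ \forall j\in J(\overline{x})\Big\}\subseteq T_M(\overline{x}).$$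
   Context: $X$ is a real Banach space with topological dual $X^*$ and duality pairing $\langle\cdot,\cdot\rangle$. A function $f\colon X\to\mathbb{R}$ is directionally differentiable (d.d.) at $x$ if for every $v\in X$ the finite limit $f'(x,v)=\lim_{\alpha\to+0}(f(x+\alpha v)-f(x))/\alpha$ exists. It is d.d. at $x$ uniformly along finite dimensional spaces if it is d.d. at $x$ and for any $v\in X$, any finite dimensional subspace $X_0\subset X$ and any $\varepsilon>0$ there is $\delta>0$ such that $|(f(x+\alpha v')-f(x))/\alpha-f'(x,v)|<\varepsilon$ for all $\alpha\in(0,\delta)$ and $v'\in v+X_0$ with $\|v'-v\|<\delta$. $f$ is quasidifferentiable at $x$ if it is d.d. at $x$ and there is a pair $[\underline{\partial} f(x),\overline{\partial} f(x)]$ (a quasidifferential; subdifferential and superdifferential) of convex weak$^*$ compact subsets of $X^*$ with $f'(x,v)=\max_{x^*\in\underline{\partial} f(x)}\langle x^*,v\rangle+\min_{y^*\in\overline{\partial} f(x)}\langle y^*,v\rangle$ for all $v\in X$; it is quasidifferentiable uniformly along finite dimensional spaces if additionally d.d. uniformly along finite dimensional spaces. Quasidifferentials are not unique; a specific one is fixed for each function and all conditions refer to it. For $C\subset X^*$, $s(C,v)=\sup_{x^*\in C}\langle x^*,v\rangle$ is the support function. The contingent cone $T_M(x)$ to $M$ at $x\in M$ is the set of $v\in X$ for which there exist $\alpha_n\to+0$ and $v_n\to v$ with $x+\alpha_n v_n\in M$ for all $n$. Sums like $A+y^*$ are Minkowski sums. *)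

(* Defs.v *)
From HB Require Import structures.
From mathcomp Require Import all_boot all_order all_algebra.
From mathcomp Require Import all_classical all_reals all_analysis.
Set Implicit Arguments. Unset Strict Implicit. Unset Printing Implicit Defensive.
Import Order.TTheory GRing.Theory Num.Theory.
Import numFieldNormedType.Exports.
Local Open Scope classical_set_scope.
Local Open Scope ring_scope.

Section Defs.
Variables (R : realType) (X : normedModType R).

Definition is_dual (phi : X -> R) : Prop :=
  (forall (a : R) (u w : X), phi (a *: u + w) = a * phi u + phi w) /\ continuous phi.

(* convex weak* compact subset of X^* ; weak* topology = topology of
   pointwise convergence on X, i.e. the product topology {ptws X -> R} *)
Definition wstar_cc (C : set (X -> R)) : Prop :=
  C `<=` is_dual /\
  (forall (t : R) phi psi, 0 <= t <= 1 -> C phi -> C psi ->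
      C (fun u => t * phi u + (1 - t) * psi u)) /\
  @compact {ptws X -> R} C.

Definition suppf (C : set (X -> R)) (v : X) : R := sup [set phi v | phi in C].

Definition mink_add (C : set (X -> R)) (y : X -> R) : set (X -> R) :=
  [set (fun u => phi u + y u) | phi in C].
Definition mink_negsub (x : X -> R) (C : set (X -> R)) : set (X -> R) :=
  [set (fun u => - x u - phi u) | phi in C].

Definition dir_deriv_is (f : X -> R) (x v : X) (d : R) : Prop :=
  (fun a : R => (f (x + a *: v) - f x) / a) @ 0^'+ --> d.

Definition dir_diff (f : X -> R) (x : X) : Prop :=
  forall v, exists d, dir_deriv_is f x v d.

(* directionally differentiable uniformly along finite dimensional spaces;
   a finite dimensional subspace X0 is the span of a finite family e *)
Definition dir_diff_unif (f : X -> R) (x : X) : Prop :=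
  dir_diff f x /\
  forall (v : X) (n : nat) (e : 'I_n -> X) (eps : R), 0 < eps ->
    forall d, dir_deriv_is f x v d ->
    exists delta : R, 0 < delta /\
      forall (a : R) (c : 'I_n -> R), 0 < a < delta ->
        let v' := v + \sum_(i < n) c i *: e i in
        `|v' - v| < delta ->
        `|(f (x + a *: v') - f x) / a - d| < eps.

(* [sub, sup] is a quasidifferential of f at x (max/min are attained since the
   sets are nonempty weak* compact; we write sup / inf) *)
Definition quasidiff (f : X -> R) (x : X) (sub sup_ : set (X -> R)) : Prop :=
  dir_diff f x /\ wstar_cc sub /\ wstar_cc sup_ /\
  sub !=set0 /\ sup_ !=set0 /\
  forall v, dir_deriv_is f x v
    (sup [set phi v | phi in sub] + inf [set psi v | psi in sup_]).

Definition quasidiff_unif (f : X -> R) (x : X) (sub sup_ : set (X -> R)) : Prop :=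
  quasidiff f x sub sup_ /\ dir_diff_unif f x.

Definition usc_at (g : X -> R) (x : X) : Prop :=
  forall eps : R, 0 < eps -> \forall y \near x, g y < g x + eps.

Definition contingent (M : set X) (x : X) : set X :=
  [set v | exists (a : nat -> R) (w : nat -> X),
     (forall n, 0 < a n) /\ a @ \oo --> 0 /\ w @ \oo --> v /\
     (forall n, M (x + a n *: w n))].

End Defs.

(* Main.v *)
(** Write p_i = s(sub f_i + y_i, .) and q_i = s(-x_i - sup f_i, .).  These are
    sublinear and -q_i <= f_i'(xb, .) <= p_i.  For v in the cone and small t > 0,
    u = v + t v_0 makes the active inequality constraints strictly decrease.  Put
      h(c) = u + sum_i (max(-c_i, 0) v_i + max(c_i, 0) w_i),   c in [-r, r]^m;
    by sublinearity f_i'(xb, h(c)) is negative on the face c_i = -r and positive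
    on the face c_i = r.  Uniformity along the span of the v_i and w_i, together
    with compactness of the faces, transfers these signs to f_i(xb + a h(c)) for
    all small a > 0, and the Poincare-Miranda theorem yields c with
    f_i(xb + a h(c)) = 0 for every i.

    The Poincare-Miranda theorem is the limit of a discrete statement on a grid.
    Let s_i be the 0-1 function "F_i > 0"; the cup product ds_1 u ... u ds_m mod 2
    is the coboundary of s_1 u ds_2 u ... u ds_m, so by Stokes and induction on m
    its sum over the cube is 1, and some cell meets both signs of every F_i. *)
Require Import Defs.
From HB Require Import structures.
From mathcomp Require Import all_boot all_order all_algebra.
From mathcomp Require Import all_classical all_reals all_analysis.
From mathcomp Require Import lra ring.
Set Implicit Arguments.
Unset Strict Implicit.
Unset Printing Implicit Defensive.
Import Order.TTheory GRing.Theory Num.Theory.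
Import numFieldNormedType.Exports.
Local Open Scope ring_scope.

(** * Cup products mod 2 on a grid *)

(* [bool] carries the ring structure of the two-element field. *)
Lemma addr_bool2 (u : bool) : u + u = 0 :> bool.
Proof. by case: u. Qed.

(** The terms at (a, b) and (b, a) are equal bits and cancel; the order on indices selects one from
    each pair. *)
Lemma sum_sym_offdiag (m : nat) (A : {set 'I_m}) (F : 'I_m -> 'I_m -> bool) :
  (forall a b, F a b = F b a) -> \sum_(a in A) \sum_(b in A :\ a) F a b = 0.
Proof.
move=> symF; rewrite pair_big_dep /= (bigID (fun p : 'I_m * 'I_m => (p.1 < p.2)%N)) /=.
rewrite [X in _ + X](reindex_inj (h := fun p : 'I_m * 'I_m => (p.2, p.1))) /=; last first.
  by move=> [a b] [c d] /= [-> ->].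
rewrite [X in _ + X](eq_big (fun p : 'I_m * 'I_m =>
  [&& p.1 \in A, p.2 \in A :\ p.1 & (p.1 < p.2)%N]) (fun p => F p.1 p.2)).
- by under eq_bigl do rewrite -andbA; exact: addr_bool2.
- move=> [a b] /=; rewrite !inE -leqNgt leq_eqVlt val_eqE andbC.
  have [->|ab] := eqVneq a b; first by rewrite ltnn !andbF.
  by rewrite /=; case: (a \in A); case: (b \in A); rewrite ?andbT ?andbF.
- by move=> [a b] _; exact: symF.
Qed.

Section PathCochain.
Variables (m : nat) (V : zmodType) (e : 'I_m -> V) (sg : 'I_m -> pred V).

(* The cup product of the coboundaries of [sg k], [k] in [l], on the union of
   the Kuhn simplices based at [x] that use only the directions in [A]: a sum
   over monotone lattice paths. *)
Fixpoint path_cochain (l : seq 'I_m) (x : V) (A : {set 'I_m}) : bool :=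
  if l is k :: l' then
    \sum_(a in A) (sg k (x + e a) + sg k x) * path_cochain l' (x + e a) (A :\ a)
  else 1.

(* The mod 2 cocycle identity; it needs no relation between [size l] and [#|A|]. *)
Lemma path_cochain_closed l x (A : {set 'I_m}) :
  \sum_(a in A) path_cochain l (x + e a) (A :\ a) =
  \sum_(a in A) path_cochain l x (A :\ a).
Proof.
elim: l x A => [//|k l IH] x A /=.
pose G a b := path_cochain l (x + e a + e b) (A :\ a :\ b).
have symG a b : G a b = G b a by rewrite /G addrAC finset.setDDl finset.setUC -finset.setDDl.
have swap (F : 'I_m -> 'I_m -> bool) : \sum_(a in A) \sum_(b in A :\ a) F a b =
    \sum_(a in A) \sum_(b in A :\ a) F b a.
  rewrite (exchange_big_dep (mem A)) /=; last by move=> a b _; rewrite inE => /andP [].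
  by apply: eq_bigr => a aA; apply: eq_bigl => b; rewrite !inE aA andbT andbC eq_sym.
have closed b : b \in A ->
    \sum_(a in A :\ b) path_cochain l (x + e b) (A :\ a :\ b) = \sum_(a in A :\ b) G b a.
  move=> _; rewrite [RHS]IH; apply: eq_bigr => a _.
  by rewrite finset.setDDl finset.setUC -finset.setDDl.
(* Terms symmetric in [a] and [b] cancel in pairs. *)
transitivity (\sum_(a in A) \sum_(b in A :\ a) sg k (x + e a) * G a b).
  transitivity (\sum_(a in A) \sum_(b in A :\ a) sg k (x + e a + e b) * G a b +
                \sum_(a in A) \sum_(b in A :\ a) sg k (x + e a) * G a b).
    rewrite -big_split; apply: eq_bigr => a _; rewrite -big_split.
    by apply: eq_bigr => b _; rewrite mulrDl.
  by rewrite sum_sym_offdiag ?add0r // => a b; rewrite symG addrAC.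
rewrite [RHS]swap.
transitivity (\sum_(b in A) (sg k (x + e b) + sg k x) *
   \sum_(a in A :\ b) path_cochain l (x + e b) (A :\ a :\ b)); last first.
  by apply: eq_bigr => b _; rewrite mulr_sumr.
rewrite [RHS](eq_bigr (fun b => \sum_(a in A :\ b) sg k (x + e b) * G b a +
   sg k x * \sum_(a in A :\ b) G b a)); last first.
  by move=> b bA; rewrite closed // mulrDl mulr_sumr.
by rewrite big_split /= -mulr_sumr (@sum_sym_offdiag _ _ G) // mulr0 addr0.
Qed.

(** A nonzero sum has a nonzero term, that is, a lattice path whose step for [k] flips [sg k]; the
    ends of that step are the two partial sums. *)
Lemma path_cochain_edge l x (A : {set 'I_m}) k : path_cochain l x A -> k \in l ->
  exists S T : {set 'I_m}, [/\ S \subset A, T \subset A &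
    sg k (x + \sum_(a in S) e a) != sg k (x + \sum_(a in T) e a)].
Proof.
elim: l x A => [//|k' l IH] x A /= nz; rewrite inE.
have [a aA /andP [ne nz']] : exists2 a, a \in A &
    (sg k' (x + e a) (+) sg k' x) && path_cochain l (x + e a) (A :\ a).
  apply/exists_inP; apply: contraTT nz => /exists_inPn zero.
  rewrite big1 // => a /zero h; exact/negbTE.
move=> /predU1P [->|/(IH _ _ nz') [S [T [SA TA neq]]]].
  exists [set a], finset.set0; rewrite finset.sub1set aA finset.sub0set big_set1 big_set0 addr0; split=> //.
  by move: ne; case: (sg k' (x + e a)); case: (sg k' x).
(* The pair found by induction is based at [x + e a]; adding [a] to both subsets moves the base back
   to [x]. *)
have ext (U : {set 'I_m}) : U \subset A :\ a ->
    (a |: U \subset A) /\ x + \sum_(b in a |: U) e b = x + e a + \sum_(b in U) e b.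
  move=> /subsetD1P [UA aU]; rewrite big_setU1 // addrA finset.subUset finset.sub1set aA UA //.
have [? eqS] := ext S SA; have [? eqT] := ext T TA.
by exists (a |: S), (a |: T); rewrite eqS eqT.
Qed.
End PathCochain.

(** * The discrete Poincare-Miranda theorem *)

Section DiscreteMiranda.
Variables (m n : nat).
(* Addition on the grid is modulo [n.+2]: the torus structure turns telescoping
   sums into reindexing by a translation. *)
Local Notation grid := {ffun 'I_m -> 'I_n.+2}.
Variable sg : 'I_m -> pred grid.
Hypothesis sg_lo : forall (i : 'I_m) (x : grid), x i = 0 -> sg i x = false.
Hypothesis sg_hi : forall (i : 'I_m) (x : grid), x i = ord_max -> sg i x = true.

Definition grid_dir (a : 'I_m) : grid := [ffun j => (j == a)%:R].
Local Notation e := grid_dir.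
Local Notation P := (path_cochain e sg).

Lemma sum_grid_dir (S : {set 'I_m}) j : (\sum_(a in S) e a) j = (j \in S)%:R.
Proof.
rewrite sum_ffunE; under eq_bigr do rewrite ffunE.
have [jS|jS] := boolP (j \in S).
  rewrite (bigD1 j) //= eqxx big1 ?addr0 // => a /andP [_ /negbTE].
  by rewrite eq_sym => ->.
rewrite big1 // => a aS; case: eqVneq => // ja; by rewrite ja aS in jS.
Qed.

(** Steps in [A] never change coordinate [a], so [sg a] is constant on all vertices involved and no
    edge can flip it. *)
Lemma path_cochain_face l (x : grid) (A : {set 'I_m}) a : a \in l -> a \notin A ->
  x a = 0 \/ x a = ord_max -> P l x A = 0.
Proof.
move=> al aA xa; apply/negbTE/negP => /path_cochain_edge /(_ al) [S [T [SA TA]]].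
have stay (U : {set 'I_m}) : U \subset A -> (x + \sum_(b in U) e b) a = x a.
  move=> UA; rewrite ffunE sum_grid_dir; case: (boolP (a \in U)) => [|_]; last exact: addr0.
  by move/(fintype.subsetP UA); rewrite (negbTE aA).
by case: xa => xa; [rewrite !sg_lo ?stay|rewrite !sg_hi ?stay].
Qed.

(* Base points of the cells in the face where the first [k] coordinates are
   maximal; coordinate [a], if any, is left unconstrained. *)
Definition partial_box (k : nat) (a : option 'I_m) (x : grid) :=
  [forall j, (Some j != a) ==> ((x j == ord_max) == (j < k)%N)].

Lemma partial_box_free (k : nat) (a : 'I_m) (x : grid) : (k <= a)%N ->
  partial_box k None x = partial_box k (Some a) x && (x a != ord_max).
Proof.
move=> ka; apply/forallP/andP => [H|[/forallP H xa] j].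
  split; last by have /eqP -> := H a; rewrite -leqNgt.
  by apply/forallP => j; rewrite (eqP (H j)) eqxx implybT.
have [->|ja] := eqVneq j a; first by rewrite (negbTE xa) /= eq_sym eqbF_neg -leqNgt.
by have := H j; rewrite (inj_eq Some_inj) ja.
Qed.

Lemma partial_boxS (k : nat) (a : 'I_m) (x : grid) : k = a ->
  partial_box k.+1 None x = partial_box k (Some a) x && (x a == ord_max).
Proof.
move=> ka; apply/forallP/andP => [H|[/forallP H xa] j].
  split; last by have /eqP -> := H a; rewrite ka ltnSn.
  apply/forallP => j; apply/implyP => ja.
  by rewrite (inj_eq Some_inj) in ja; rewrite (eqP (H j)) ltnS leq_eqVlt ka val_eqE (negbTE ja).
have [->|ja] := eqVneq j a; first by rewrite xa ka ltnSn.
have := H j; rewrite (inj_eq Some_inj) ja => /eqP ->.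
by rewrite ltnS [(j <= k)%N]leq_eqVlt ka val_eqE (negbTE ja) /=.
Qed.

(** Since coordinate [a] is unconstrained, translation by [e a] permutes this box; this is what
    makes sums telescope around the torus. *)
Lemma partial_box_shift (k : nat) (a : 'I_m) (x : grid) :
  partial_box k (Some a) (x + e a) = partial_box k (Some a) x.
Proof.
apply: eq_forallb => j; rewrite (inj_eq Some_inj); have [//|ja /=] := eqVneq j a.
by rewrite !ffunE (negbTE ja) addr0.
Qed.

(** Downward induction on [k] from [m], where the box is a single corner and the empty product is 1.
    Stokes identifies the sum at [k] with the sum at [k.+1]; [k = 0] is the whole cube. *)
Lemma sum_partial_box k : (k <= m)%N ->
  \sum_(x : grid | partial_box k None x)
    P (drop k (enum 'I_m)) x [set j : 'I_m | (k <= j)%N] = 1.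
Proof.
move=> km; rewrite -(subKn km); elim: (m - k)%N (leq_subr k m) => {k km} [_|k IH km].
  rewrite subn0 drop_oversize ?size_enum_ord //.
  rewrite (big_pred1 [ffun=> ord_max]) // => x; apply/forallP/eqP => [H|-> j].
    by apply/ffunP => j; rewrite ffunE; have /eqP := H j; rewrite ltn_ord => /eqP.
  by rewrite ffunE eqxx ltn_ord.
set K := (m - k.+1)%N; have KS : K.+1 = (m - k)%N by rewrite /K subnSK.
have Km : (K < m)%N by rewrite KS leq_subr.
(* [a0] is the first direction not yet fixed at its maximum, and [l] lists the directions after
   it. *)
pose a0 := Ordinal Km; pose A : {set 'I_m} := [set j : 'I_m | (K <= j)%N].
pose l := drop K.+1 (enum 'I_m).
have AD1 : A :\ a0 = [set j : 'I_m | (K.+1 <= j)%N].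
  by apply/setP => j; rewrite !inE ltn_neqAle -val_eqE eq_sym.
have memA (a : 'I_m) : a \in A -> a != a0 -> a \in l.
  move=> aA aa0; have : a \in A :\ a0 by rewrite !inE aa0; rewrite inE in aA.
  rewrite AD1 inE => Ka; rewrite -[a](nth_ord_enum a a) -(subnKC Ka) -nth_drop mem_nth //.
  by rewrite size_drop size_enum_ord ltn_sub2r // (leq_ltn_trans Ka).
rewrite (drop_nth a0) ?size_enum_ord // -[K in nth _ _ K]/(val a0) nth_ord_enum -/A -/l /=.
(* By the cocycle identity the summand is the divergence of
   [sg a0 * path_cochain l], so only the faces of the box contribute. *)
pose psi (a : 'I_m) x := sg a0 x * P l x (A :\ a).
transitivity (\sum_(x : grid | partial_box K None x) \sum_(a in A) (psi a (x + e a) + psi a x)).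
  apply: eq_bigr => x _; rewrite big_split -mulr_sumr -path_cochain_closed mulr_sumr -big_split.
  by apply: eq_bigr => a _; rewrite mulrDl.
(* With coordinate [a] free, translation by [e a] makes the total vanish mod 2, so the part with
   [x a] not maximal equals the part with [x a] maximal. *)
have slab (a : 'I_m) : a \in A ->
    \sum_(x : grid | partial_box K None x) (psi a (x + e a) + psi a x) =
    \sum_(x : grid | partial_box K (Some a) x && (x a == ord_max)) (psi a (x + e a) + psi a x).
  rewrite inE => aA; apply/eqP; rewrite -subr_eq0; apply/eqP.
  under eq_bigl do rewrite (@partial_box_free _ a) //.
  transitivity (\sum_(x : grid | partial_box K (Some a) x) (psi a (x + e a) + psi a x)).
    (* [congr] closes the goal because opposite is the identity on [bool]. *)
    by rewrite [RHS](bigID (fun x : grid => x a == ord_max)) /= addrC; congr (_ + _).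
  rewrite big_split /=.
  rewrite [X in _ + X](reindex_inj (addIr (e a))) /=.
  under [X in _ + X]eq_bigl do rewrite partial_box_shift.
  exact: addr_bool2.
have wrap (a : 'I_m) (x : grid) : x a = ord_max -> (x + e a) a = 0.
  by move=> xa; rewrite !ffunE xa eqxx; apply: val_inj; rewrite /= addn1 modnn.
(* Lower faces contribute nothing: [sg a0] vanishes on the one of [a0], and on the others [sg a] is
   constant while [a] occurs in [l]. *)
have psi_lo (a : 'I_m) (x : grid) : a \in A -> x a = 0 -> psi a x = 0.
  move=> aA xa; rewrite /psi; have [aa0|ne] := eqVneq a a0.
    by rewrite sg_lo ?mul0r // -aa0.
  rewrite (@path_cochain_face _ _ _ a) ?mulr0 ?memA ?finset.setD11 //; by left.
rewrite exchange_big /=.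
(* Of the upper faces only that of [a0] survives; there [sg a0] is 1 and the sum at level [K.+1]
   appears. *)
rewrite (eq_bigr _ slab) (bigD1 a0) ?inE //=.
rewrite [X in _ + X]big1 ?addr0 => [|a /andP [aA ne]].
  rewrite -IH; last exact: ltnW.
  rewrite -KS; apply: eq_big => x; first by rewrite (@partial_boxS _ a0).
  move=> /andP [_ /eqP xa]; rewrite psi_lo ?inE ?add0r ?/psi ?sg_hi ?AD1 ?mul1r //.
  exact: wrap.
apply: big1 => x /andP [_ /eqP xa]; rewrite psi_lo ?add0r //.
  rewrite /psi (@path_cochain_face _ _ _ a) ?mulr0 ?memA ?finset.setD11 //; by right.
exact: wrap.
Qed.

(** The sum at level 0 is 1, so some cell has a nonzero cochain, and this cochain yields a sign
    change of every [sg i] within that cell. *)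
Lemma discrete_miranda : exists x : grid, (forall j, x j != ord_max) /\
  forall i, exists y z : grid, [/\ ~~ sg i y, sg i z,
    forall j, y j = x j \/ y j = x j + 1 & forall j, z j = x j \/ z j = x j + 1].
Proof.
have /eqP := sum_partial_box (leq0n m).
have [x /andP [xbox nz] _|none] := pickP (fun x : grid =>
    partial_box 0 None x && P (drop 0 (enum 'I_m)) x [set j : 'I_m | (0 <= j)%N]).
  exists x; split=> [j|i]; first by have /forallP/(_ j) := xbox; rewrite eqbF_neg.
  have [] := path_cochain_edge (k := i) nz; first by rewrite drop0 mem_enum.
  move=> S [T [_ _ ne]].
  have adj (U : {set 'I_m}) j : (x + \sum_(a in U) e a) j = x j \/
      (x + \sum_(a in U) e a) j = x j + 1.
    rewrite ffunE sum_grid_dir; case: (j \in U); [by right|by left; rewrite addr0].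
  move: ne; case sgS: (sg i (x + \sum_(a in S) e a)); case sgT: (sg i (x + \sum_(a in T) e a)) => // _.
    by exists (x + \sum_(a in T) e a), (x + \sum_(a in S) e a); rewrite sgS sgT.
  by exists (x + \sum_(a in S) e a), (x + \sum_(a in T) e a); rewrite sgS sgT.
rewrite big1 // => x xbox; have := none x; by rewrite xbox.
Qed.
End DiscreteMiranda.

Local Open Scope classical_set_scope.
Local Open Scope ring_scope.

(** * The Poincare-Miranda theorem *)

Definition cube (R : realType) (m : nat) (r : R) : set 'rV[R]_m :=
  [set c | forall j, - r <= c ord0 j <= r].

Lemma cube_compact (R : realType) (m : nat) (r : R) : compact (@cube R m r).
Proof.
rewrite (_ : @cube R m r = [set c : 'rV_m | forall j, `[- r, r]%classic (c ord0 j)]); last first.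
  by apply/seteqP; split=> c /= H j; have := H j; rewrite in_itv.
apply: (@rV_compact R m (fun=> `[- r, r]%classic)) => j; exact: segment_compact.
Qed.

(** Without a common root, each point has some [F i] of one strict sign nearby. Compactness makes
    the scale uniform, against a grid cell in which every [F i] takes a positive and a nonpositive
    value. *)
Lemma poincare_miranda (R : realType) (m : nat) (r : R) (F : 'I_m -> 'rV[R]_m -> R) :
  0 < r ->
  (forall i c, cube r c -> {for c, continuous (F i)}) ->
  (forall i c, cube r c -> c ord0 i = - r -> F i c < 0) ->
  (forall i c, cube r c -> c ord0 i = r -> 0 < F i c) ->
  exists2 c, cube r c & forall i, F i c = 0.
Proof.
move=> r0 Fcont Flo Fhi; apply: contrapT => noroot.
(* With [n.+2] grid points per axis, [n.+1] steps of this length cross the interval from [- r] to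
   [r]. *)
pose mesh (n : nat) : R := 2 * r * n.+1%:R^-1.
pose P n (x : 'rV[R]_m) := exists i,
  (forall y, cube r y -> (forall j, `|x ord0 j - y ord0 j| <= mesh n) -> 0 < F i y) \/
  (forall y, cube r y -> (forall j, `|x ord0 j - y ord0 j| <= mesh n) -> F i y < 0).
have meshlt (d : R) : 0 < d -> \forall n \near \oo, mesh n < d.
  move=> d0; near=> n; rewrite /mesh.
  have h : n.+1%:R^-1 < d / (2 * r).
    by near: n; apply: (near_infty_natSinv_lt (PosNum _)); rewrite divr_gt0 // mulr_gt0.
  by rewrite mulrC -ltr_pdivlMr // mulr_gt0.
have pick_c c : cube r c -> exists i, F i c != 0.
  move=> cK; apply: contrapT => none; apply: noroot; exists c => // i.
  by apply: contrapT => /eqP Fi; apply: none; exists i.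
(* Compactness turns the threshold on [n] found near each point into one for the whole cube. *)
have : \forall n \near \oo, cube r `<=` P n.
  have /compact_near_coveringP := @cube_compact R m r; apply => c cK.
  have [i Fi] := pick_c c cK.
  suff [d d0 sgn] : exists2 d : R, 0 < d &
    (forall y, ball c d y -> 0 < F i y) \/ (forall y, ball c d y -> F i y < 0).
    near=> x n => /=.
    (* The radius [d] is split in two: [x] is within [d / 2] of [c], and [y] within [mesh n < d / 2]
       of [x]. *)
    have clo (y : 'rV[R]_m) : (forall j, `|x ord0 j - y ord0 j| <= mesh n) -> ball c d y.
      move=> xy; split=> // i' j; rewrite (ord1 i').
      have cx : ball c (d / 2) x by near: x; apply: nbhsx_ballx; rewrite divr_gt0.
      have mn : mesh n < d / 2 by near: n; apply: meshlt; rewrite divr_gt0.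
      have /(_ ord0 j) cxj := cx.2; rewrite /ball /= in cxj *.
      have := xy j => xyj.
      rewrite -(subrKA (x ord0 j)) [d]splitr; apply: le_lt_trans (ler_normD _ _) _.
      by rewrite ltrD // (le_lt_trans xyj).
    by exists i; case: sgn => sgn; [left|right] => y _ /clo /sgn.
  have cF := Fcont i c cK.
  have [Fneg|Fpos|F0] := ltgtP (F i c) 0; last by rewrite F0 eqxx in Fi.
    have : \forall y \near c, F i y < 0 by exact: (cvgr_lt _ cF).
    by move=> /nbhs_ballP [d d0 H]; exists d => //; right => y /H.
  have : \forall y \near c, 0 < F i y by exact: (cvgr_gt _ cF).
  by move=> /nbhs_ballP [d d0 H]; exists d => //; left => y /H.
move=> /filter_ex [n KP].
pose pt (x : {ffun 'I_m -> 'I_n.+2}) : 'rV[R]_m := \row_j (- r + mesh n * (x j)%:R).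
have meshn : mesh n * n.+1%:R = 2 * r by rewrite /mesh mulfVK.
have mesh0 : 0 < mesh n by rewrite /mesh mulr_gt0 ?invr_gt0 // mulr_gt0.
have ptK x : cube r (pt x).
  move=> j; rewrite mxE.
  have : 0 <= mesh n * (x j)%:R <= 2 * r.
    by rewrite -meshn ler_pM2l // ler_nat -ltnS ltn_ord andbT mulr_ge0 ?ler0n // ltW.
  by lra.
have [||x [xlt xP]] := @discrete_miranda m n (fun i x => 0 < F i (pt x)).
- move=> i x xi; apply/negbTE; rewrite -leNgt; apply/ltW/Flo => //.
  by rewrite mxE xi mulr0 addr0.
- move=> i x xi; apply: Fhi => //.
  by rewrite mxE xi /= meshn; ring.
have [i Pi] := KP _ (ptK x).
have [y [z [Fy Fz xy xz]]] := xP i.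
have adj (u : {ffun 'I_m -> 'I_n.+2}) : (forall j, u j = x j \/ u j = x j + 1) ->
    forall j, `|pt x ord0 j - pt u ord0 j| <= mesh n.
  move=> xu j; rewrite !mxE; case: (xu j) => ->; first by rewrite subrr normr0 ltW.
  (* The addition does not wrap around, because [x j] is not [ord_max]. *)
  have -> : val (x j + 1) = (x j).+1.
    rewrite /= addn1 modn_small //; have := ltn_ord (x j); rewrite ltnS leq_eqVlt => /orP [/eqP e|//].
    by have /eqP [] := xlt j; apply: val_inj.
  rewrite -natr1 (_ : _ - _ = - mesh n); last by ring.
  by rewrite normrN gtr0_norm.
case: Pi => H.
  by move: Fy; rewrite H // ; apply: adj.
by move: Fz; rewrite ltNge ltW // H //; apply: adj.
Unshelve. all: by end_near.
Qed.

(** * Support functions and directional derivatives *)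

Section Sublinear.
Variables (R : realType) (X : normedModType R).

(** Homogeneity is an inequality with [a = 0] included, which gives [p 0 <= 0]. *)
Definition sublinear (p : X -> R) :=
  (forall u w, p (u + w) <= p u + p w) /\ (forall a u, 0 <= a -> p (a *: u) <= a * p u).

(** A term with zero coefficient contributes at most [p 0 <= 0], so the sign of [p (e k)] matters
    only where [0 < t k]; the term [k0] makes the inequality strict. *)
Lemma sublinear_sum_lt0 (p : X -> R) (n : nat) (u : X) (t : 'I_n -> R) (e : 'I_n -> X)
    (k0 : 'I_n) :
  sublinear p -> p u <= 0 -> (forall k, 0 <= t k) -> (forall k, 0 < t k -> p (e k) <= 0) ->
  0 < t k0 -> p (e k0) < 0 -> p (u + \sum_k t k *: e k) < 0.
Proof.
move=> [psub phom] pu t0 pe tk0 pek0.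
have term k : p (t k *: e k) <= 0.
  apply: le_trans (phom _ _ (t0 k)) _; have := t0 k; rewrite le_eqVlt => /orP [/eqP <-|tk].
    by rewrite mul0r.
  by rewrite mulr_ge0_le0 ?pe // ltW.
have p0 : p 0 <= 0 by have := phom 0 0 (lexx 0); rewrite scale0r mul0r.
have sum0 (Q : pred 'I_n) : p (\sum_(k | Q k) t k *: e k) <= 0.
  elim/big_rec: _ => [//|k y _ py]; apply: le_trans (psub _ _) _.
  by rewrite -[0]addr0 lerD.
rewrite (bigD1 k0) //=.
have neg : p (t k0 *: e k0) < 0 by apply: le_lt_trans (phom _ _ (t0 k0)) _; rewrite pmulr_rlt0.
have := psub u (t k0 *: e k0 + \sum_(k | k != k0) t k *: e k).
have := psub (t k0 *: e k0) (\sum_(k | k != k0) t k *: e k).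
have := sum0 (fun k => k != k0).
by move: pu neg; lra.
Qed.

(** Evaluation at [v] is a coordinate projection of the product topology, so it maps [C] onto a
    compact, hence bounded, set of reals. *)
Lemma ptws_compact_eval_bounded (C : set (X -> R)) (v : X) : @compact {ptws X -> R} C ->
  has_ubound [set phi v | phi in C] /\ has_lbound [set phi v | phi in C].
Proof.
move=> cC.
have : compact [set phi v | phi in C].
  apply: (@continuous_compact {ptws X -> R} R (fun phi => phi v)) => //.
  by apply: continuous_subspaceT => phi; exact: (@proj_continuous X (fun=> R) v).
move=> /compact_bounded [M [_ HM]].
have HM1 := HM (M + 1) (ltr_pwDr ltr01 (lexx M)).
split; [exists (M + 1)|exists (- (M + 1))] => _ [phi Cphi <-].
  by apply: le_trans (ler_norm _) _; apply: HM1 => //; exists phi.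
by rewrite lerNl; apply: le_trans (ler_norm _) _; rewrite normrN; apply: HM1 => //; exists phi.
Qed.

Definition linear_fun (phi : X -> R) := forall (a : R) u w, phi (a *: u + w) = a * phi u + phi w.

Lemma linear_funD phi u w : linear_fun phi -> phi (u + w) = phi u + phi w.
Proof. by move=> L; rewrite -[in LHS](scale1r u) L mul1r. Qed.

Lemma linear_funZ phi a u : linear_fun phi -> phi (a *: u) = a * phi u.
Proof.
move=> L; have z : phi 0 = 0 by have := linear_funD 0 0 L; rewrite addr0 => /eqP; rewrite -subr_eq0 opprD addNKr oppr_eq0 => /eqP.
by rewrite -[a *: u]addr0 L z addr0.
Qed.

Lemma suppf_ge (C : set (X -> R)) phi v :
  has_ubound [set phi v | phi in C] -> C phi -> phi v <= suppf C v.
Proof. by move=> ub Cphi; apply: ub_le_sup => //; exists phi. Qed.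

Lemma suppf_le (C : set (X -> R)) v b :
  C !=set0 -> (forall phi, C phi -> phi v <= b) -> suppf C v <= b.
Proof.
move=> [phi Cphi] H; apply: ge_sup; first by exists (phi v), phi.
by move=> _ [psi Cpsi <-]; exact: H.
Qed.

Lemma suppf_sublinear (C : set (X -> R)) : C !=set0 -> (forall phi, C phi -> linear_fun phi) ->
  (forall v, has_ubound [set phi v | phi in C]) -> sublinear (suppf C).
Proof.
move=> C0 lin ub; split=> [u w|a u a0]; apply: suppf_le => // phi Cphi.
  by rewrite linear_funD ?lerD ?suppf_ge //; exact: lin.
by rewrite linear_funZ ?ler_wpM2l ?suppf_ge //; exact: lin.
Qed.

Lemma suppf_mink_add_sublinear (C : set (X -> R)) y : C !=set0 -> wstar_cc C -> is_dual y ->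
  sublinear (suppf (mink_add C y)).
Proof.
move=> [phi0 C0] [Cd [_ cC]] [ylin _]; apply: suppf_sublinear.
- by exists (fun u => phi0 u + y u), phi0.
- by move=> _ [phi /Cd [L _] <-] a u w; rewrite L ylin; ring.
move=> v; have [[b ub] _] := ptws_compact_eval_bounded v cC.
by exists (b + y v) => _ [_ [phi Cphi <-] <-]; rewrite lerD2r; apply: ub; exists phi.
Qed.

Lemma suppf_mink_negsub_sublinear x (C : set (X -> R)) : C !=set0 -> wstar_cc C -> is_dual x ->
  sublinear (suppf (mink_negsub x C)).
Proof.
move=> [phi0 C0] [Cd [_ cC]] [xlin _]; apply: suppf_sublinear.
- by exists (fun u => - x u - phi0 u), phi0.
- by move=> _ [phi /Cd [L _] <-] a u w; rewrite L xlin; ring.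
move=> v; have [_ [b lb]] := ptws_compact_eval_bounded v cC.
by exists (- x v - b) => _ [_ [phi Cphi <-] <-]; rewrite lerD2l lerN2; apply: lb; exists phi.
Qed.

Definition qd_deriv (sub sup_ : set (X -> R)) (v : X) :=
  sup [set phi v | phi in sub] + inf [set psi v | psi in sup_].

(** The infimum over the superdifferential is at most the value at the chosen element [y]. *)
Lemma qd_deriv_le (f : X -> R) x sub sup_ y v : quasidiff f x sub sup_ -> sup_ y ->
  qd_deriv sub sup_ v <= suppf (mink_add sub y) v.
Proof.
move=> [_ [[subd [_ csub]] [[_ [_ csup]] [[phi0 sub0] [_ _]]]]] supy.
have [[b ub] _] := ptws_compact_eval_bounded v csub.
have [_ lb] := ptws_compact_eval_bounded v csup.
rewrite /qd_deriv -lerBrDr; apply: ge_sup; first by exists (phi0 v), phi0.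
move=> _ [phi subphi <-]; rewrite lerBrDr.
apply: (@le_trans _ _ (phi v + y v)).
  by rewrite lerD2l; apply: ge_inf => //; exists y.
apply: (@suppf_ge _ (fun u => phi u + y u)); last by exists phi.
by exists (b + y v) => _ [_ [psi Cpsi <-] <-]; rewrite lerD2r; apply: ub; exists psi.
Qed.

(** Dually, the supremum over the subdifferential is at least the value at [y]. *)
Lemma qd_deriv_ge (f : X -> R) x sub sup_ y v : quasidiff f x sub sup_ -> sub y ->
  - suppf (mink_negsub y sup_) v <= qd_deriv sub sup_ v.
Proof.
move=> [_ [[_ [_ csub]] [[_ [_ csup]] [_ [[phi0 sup0] _]]]]] suby.
have [ub _] := ptws_compact_eval_bounded v csub.
have [_ [b lb]] := ptws_compact_eval_bounded v csup.
rewrite /qd_deriv addrC -lerBlDr; apply: lb_le_inf; first by exists (phi0 v), phi0.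
move=> _ [phi supphi <-]; rewrite lerBlDr lerNl.
apply: (@le_trans _ _ (- y v - phi v)).
  by rewrite opprD addrC lerD2r lerN2; apply: ub_le_sup => //; exists y.
apply: (@suppf_ge _ (fun u => - y u - phi u)); last by exists phi.
by exists (- y v - b) => _ [_ [psi Cpsi <-] <-]; rewrite lerD2l lerN2; apply: lb; exists psi.
Qed.
End Sublinear.

(** * Signs along a continuous family of directions *)

Section Family.
Variables (R : realType) (X : normedModType R) (m n : nat).
Variables (x u : X) (e : 'I_n -> X) (t : 'rV[R]_m -> 'I_n -> R).
Hypothesis t_cont : forall k, continuous (t ^~ k).

(** Affine in the coefficients, which may depend nonlinearly on [c]; any two values differ by an
    element of the span of [e]. *)
Definition affine_family (c : 'rV[R]_m) : X := u + \sum_k t c k *: e k.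

Lemma affine_family_continuous : continuous affine_family.
Proof.
move=> c; apply: (@cvgD _ _ _ (nbhs c) _ (fun=> u) (fun c => \sum_k t c k *: e k)).
  exact: cvg_cst.
apply: (@cvg_big _ _ _ _ _ _ _ (nbhs c) _ (fun k c => t c k *: e k)) => [|k _].
  exact: add_continuous.
by apply: cvgZr_tmp; exact: t_cont.
Qed.

(** Near [c] the directions stay bounded by the norm at [c] plus 1, so one bound on [a] serves them
    all. *)
Lemma near_affine_family (U : set X) (c : 'rV[R]_m) : nbhs x U ->
  \forall c' \near c & a \near 0^'+, U (x + a *: affine_family c').
Proof.
move=> /nbhs_ballP [d /= d0 dU].
have M0 : 0 < `|affine_family c| + 1 by rewrite ltr_wpDl.
near=> c' a => /=; apply: dU; rewrite -ball_normE /= opprD addNKr normrN normrZ.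
have a0 : 0 < a by near: a; exact: nbhs_right_gt.
have ad : a < d / (`|affine_family c| + 1) by near: a; apply: nbhs_right_lt; rewrite divr_gt0.
have c'c : `|affine_family c - affine_family c'| < 1.
  by near: c'; have /cvgrPdist_lt := @affine_family_continuous c; apply.
rewrite gtr0_norm //; rewrite ltr_pdivlMr // in ad; apply: le_lt_trans ad.
rewrite ler_pM2l //; have := ler_normD (affine_family c) (affine_family c' - affine_family c).
rewrite addrC subrK distrC; move: c'c; lra.
Unshelve. all: by end_near.
Qed.

(** Changing [c] moves the direction continuously within a translate of the span of [e], exactly the
    situation covered by uniformity along finite dimensional spaces. *)
Lemma near_quotient (f : X -> R) (d eps : R) (c : 'rV[R]_m) : dir_diff_unif f x -> 0 < eps ->
  dir_deriv_is f x (affine_family c) d ->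
  \forall c' \near c & a \near 0^'+, 0 < a /\ `|(f (x + a *: affine_family c') - f x) / a - d| < eps.
Proof.
move=> [_ unif] eps0 fd; have [dl [dl0 H]] := unif _ n e eps eps0 d fd.
near=> c' a => /=.
have a0 : 0 < a by near: a; exact: nbhs_right_gt.
have ad : a < dl by near: a; exact: nbhs_right_lt.
have eqh : affine_family c' = affine_family c + \sum_k (t c' k - t c k) *: e k.
  rewrite /affine_family -addrA -big_split /=; congr (_ + _); apply: eq_bigr => k _.
  by rewrite -scalerDl addrCA subrr addr0.
split=> //; rewrite eqh; apply: H; first by rewrite a0.
rewrite -eqh distrC; near: c'; have /cvgrPdist_lt := @affine_family_continuous c; exact.
Unshelve. all: by end_near.
Qed.

Lemma near_pos (f : X -> R) (d : R) (c : 'rV[R]_m) : dir_diff_unif f x -> 0 < d ->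
  dir_deriv_is f x (affine_family c) d ->
  \forall c' \near c & a \near 0^'+, f x < f (x + a *: affine_family c').
Proof.
(* With tolerance [d] itself, the difference quotient stays positive. *)
move=> fu d0 fd; apply: filterS (near_quotient fu d0 fd) => -[c' a] /= [a0].
rewrite ltr_norml => /andP [+ _]; rewrite ltrBrDr addNr pmulr_lgt0 ?invr_gt0 //.
by rewrite subr_gt0.
Qed.

Lemma near_neg (f : X -> R) (d : R) (c : 'rV[R]_m) : dir_diff_unif f x -> d < 0 ->
  dir_deriv_is f x (affine_family c) d ->
  \forall c' \near c & a \near 0^'+, f (x + a *: affine_family c') < f x.
Proof.
move=> fu d0 fd; have nd0 : 0 < - d by rewrite oppr_gt0.
apply: filterS (near_quotient fu nd0 fd) => -[c' a] /= [a0].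
rewrite ltr_norml => /andP [_]; rewrite ltrBlDr addNr pmulr_llt0 ?invr_gt0 //.
by rewrite subr_lt0.
Qed.
End Family.

(** * Uniformity on cubes and faces, and a criterion for tangency *)

(** Half the radius of an open ball gives a closed cube inside it. *)
Lemma near_cube (R : realType) (m : nat) (Q : 'rV[R]_m -> R -> Prop) :
  (\forall c \near (0 : 'rV[R]_m) & a \near 0^'+, Q c a) ->
  exists2 r, 0 < r & \forall a \near 0^'+, forall c, cube r c -> Q c a.
Proof.
move=> [[U V] /= [/nbhs_ballP [d /= d0 dU] HV] UV].
exists (d / 2); first by rewrite divr_gt0.
apply: filterS HV => a Va c cK; apply: (UV (c, a)); split=> //; apply: dU.
split=> // i j; rewrite (ord1 i) /ball /= mxE sub0r normrN.
by have := cK j; rewrite -ler_norml => /le_lt_trans -> //; rewrite ltr_pdivrMr // ltr_pMr // ltr1n.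
Qed.

(** The face is compact, so bounds on [a] that are local in [c] combine into one. *)
Lemma cube_near_face (R : realType) (m : nat) (r s : R) (i : 'I_m) (P : R -> 'rV[R]_m -> Prop) :
  (forall c, cube r c -> c ord0 i = s -> \forall c' \near c & a \near 0^'+, P a c') ->
  \forall a \near 0^'+, forall c, cube r c -> c ord0 i = s -> P a c.
Proof.
move=> H.
have clo : closed [set c : 'rV[R]_m | c ord0 i = s].
  apply: (@preimage_closed _ _ (fun c : 'rV[R]_m => c ord0 i) [set y | y = s]); last exact: closed_eq.
  by move=> c _; exact: coord_continuous.
have /compact_near_coveringP cov := compact_closedI (@cube_compact R m r) clo.
have near0 : \forall a \near 0^'+, cube r `&` [set c | c ord0 i = s] `<=` P a.
  by apply: cov => c [cK ci]; exact: H.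
by apply: filterS near0 => a aP c cK ci; apply: aP.
Qed.

(** Choosing [eps] as the inverse of [n.+1] produces both sequences. *)
Lemma contingent_of_eps (R : realType) (X : normedModType R) (M : set X) (x v : X) :
  (forall eps : R, 0 < eps -> exists (a : R) (w : X),
     [/\ 0 < a, a < eps, `|v - w| < eps & M (x + a *: w)]) -> contingent M x v.
Proof.
move=> H.
have /choice [aw awP] : forall n : nat, exists aw : R * X, [/\ 0 < aw.1, aw.1 < n.+1%:R^-1,
    `|v - aw.2| < n.+1%:R^-1 & M (x + aw.1 *: aw.2)].
  by move=> n; have [|a [w ?]] := H (n.+1%:R^-1); [rewrite invr_gt0|exists (a, w)].
exists (fun n => (aw n).1), (fun n => (aw n).2); split; first by move=> n; case: (awP n).
split.
  apply/cvgrPdist_lt => eps eps0; near=> n; have [a0 alt _ _] := awP n.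
  rewrite sub0r normrN gtr0_norm //; apply: lt_trans alt _.
  by near: n; exact: (near_infty_natSinv_lt (PosNum eps0)).
split; last by move=> n; case: (awP n).
apply/cvgrPdist_lt => eps eps0; near=> n; have [_ _ wlt _] := awP n.
apply: lt_trans wlt _; near: n; exact: (near_infty_natSinv_lt (PosNum eps0)).
Unshelve. all: by end_near.
Qed.

(** * The family of correcting directions *)

(** Glues two families into one; the type [T] is arbitrary so that vectors and coefficients are
    glued alike. *)
Definition orthant_dir (T : Type) (m : nat) (vm vp : 'I_m -> T) (k : 'I_(m + m)) : T :=
  match fintype.split k with inl i => vm i | inr i => vp i end.

(** The negative and positive parts of the coordinates of [c]: for each [i] at most one of the two
    is nonzero. *)
Definition orthant_coef (R : realType) (m : nat) (c : 'rV[R]_m) : 'I_(m + m) -> R :=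
  orthant_dir (fun i => Num.max (- c ord0 i) 0) (fun i => Num.max (c ord0 i) 0).

Lemma orthant_coef_continuous (R : realType) (m : nat) k : continuous (fun c : 'rV[R]_m => orthant_coef c k).
Proof.
rewrite /orthant_coef /orthant_dir; case: (fintype.split k) => i.
  apply: (@max_fun_continuous _ _ _ (fun c : 'rV[R]_m => - c ord0 i) (fun=> 0)); [move=> c|exact: cst_continuous].
  exact: (cvgN (@coord_continuous R 1 m ord0 i c)).
apply: (@max_fun_continuous _ _ _ (fun c : 'rV[R]_m => c ord0 i) (fun=> 0)); [move=> c|exact: cst_continuous].
exact: coord_continuous.
Qed.

Lemma orthant_coef_ge0 (R : realType) (m : nat) (c : 'rV[R]_m) k : 0 <= orthant_coef c k.
Proof. by rewrite /orthant_coef /orthant_dir; case: (fintype.split k) => i; rewrite le_max lexx orbT. Qed.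

(** For [c ord0 i < 0] the coefficient of [vp i], where [p] has no known sign, vanishes, while
    [vm i] supplies the strict inequality. *)
Lemma sublinear_orthant_lo (R : realType) (X : normedModType R) (m : nat) (p : X -> R) (u : X)
    (vm vp : 'I_m -> X) (c : 'rV[R]_m) (i : 'I_m) :
  sublinear p -> p u <= 0 -> p (vm i) < 0 ->
  (forall k, k != i -> p (vm k) <= 0 /\ p (vp k) <= 0) -> c ord0 i < 0 ->
  p (affine_family u (orthant_dir vm vp) (@orthant_coef R m) c) < 0.
Proof.
move=> sp pu pi pk ci; apply: (@sublinear_sum_lt0 _ _ _ _ _ _ _ (unsplit (inl i))) => //.
- exact: orthant_coef_ge0.
- move=> k; rewrite /orthant_coef /orthant_dir; case: (fintype.split k) => j tk;
    (have [ji|/pk [] //] := eqVneq j i); rewrite ji; first exact: ltW.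
  by move: tk; rewrite ji lt_max ltxx orbF ltNge ltW.
- by rewrite /orthant_coef /orthant_dir unsplitK lt_max oppr_gt0 ci.
- by rewrite /orthant_dir unsplitK.
Qed.

(** The mirror image: the coefficient of [vm i] vanishes and [vp i] gives strictness. *)
Lemma sublinear_orthant_hi (R : realType) (X : normedModType R) (m : nat) (p : X -> R) (u : X)
    (vm vp : 'I_m -> X) (c : 'rV[R]_m) (i : 'I_m) :
  sublinear p -> p u <= 0 -> p (vp i) < 0 ->
  (forall k, k != i -> p (vm k) <= 0 /\ p (vp k) <= 0) -> 0 < c ord0 i ->
  p (affine_family u (orthant_dir vm vp) (@orthant_coef R m) c) < 0.
Proof.
move=> sp pu pi pk ci; apply: (@sublinear_sum_lt0 _ _ _ _ _ _ _ (unsplit (inr i))) => //.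
- exact: orthant_coef_ge0.
- move=> k; rewrite /orthant_coef /orthant_dir; case: (fintype.split k) => j tk;
    (have [ji|/pk [] //] := eqVneq j i); rewrite ji; last exact: ltW.
  by move: tk; rewrite ji lt_max ltxx orbF oppr_gt0 ltNge ltW.
- by rewrite /orthant_coef /orthant_dir unsplitK lt_max ci.
- by rewrite /orthant_dir unsplitK.
Qed.

(** * From the linearised cone to the contingent cone *)

Unset Implicit Arguments.

Theorem theorem1 (R : realType) (X : completeNormedModType R) (m l : nat)
  (f : 'I_m -> X -> R) (g : 'I_l -> X -> R)
  (subf supf : 'I_m -> set (X -> R)) (subg supg : 'I_l -> set (X -> R))
  (xb : X)
  (xs ys : 'I_m -> X -> R) (zs : 'I_l -> X -> R) :
  let M := [set x : X | (forall i, f i x = 0) /\ (forall j, g j x <= 0)] in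
  let Jx := [set j : 'I_l | g j xb = 0] in
  M xb ->
  (forall i, \forall y \near xb, {for y, continuous (f i)}) ->
  (forall j, ~ Jx j -> usc_at (g j) xb) ->
  (forall i, quasidiff_unif (f i) xb (subf i) (supf i)) ->
  (forall j, Jx j -> quasidiff_unif (g j) xb (subg j) (supg j)) ->
  (forall i, subf i (xs i) /\ supf i (ys i)) ->
  (forall j, Jx j -> supg j (zs j)) ->
  (forall i, exists v : X,
     suppf (mink_add (subf i) (ys i)) v < 0 /\
     forall k, k != i ->
       suppf (mink_add (subf k) (ys k)) v <= 0 /\ suppf (mink_negsub (xs k) (supf k)) v <= 0) ->
  (forall i, exists w : X,
     suppf (mink_negsub (xs i) (supf i)) w < 0 /\
     forall k, k != i ->
       suppf (mink_negsub (xs k) (supf k)) w <= 0 /\ suppf (mink_add (subf k) (ys k)) w <= 0) ->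
  (exists v0 : X,
     (forall j, Jx j -> suppf (mink_add (subg j) (zs j)) v0 < 0) /\
     (forall i, suppf (mink_add (subf i) (ys i)) v0 <= 0 /\
                suppf (mink_negsub (xs i) (supf i)) v0 <= 0)) ->
  [set v : X | (forall i, suppf (mink_add (subf i) (ys i)) v <= 0 /\
                          suppf (mink_negsub (xs i) (supf i)) v <= 0) /\
               (forall j, Jx j -> suppf (mink_add (subg j) (zs j)) v <= 0)]
  `<=` contingent M xb.
Proof.
move=> M Jx [fxb gxb] fcont gusc fqd gqd fsel gsel cq1 cq2 [v0 [v0g v0f]] v [vf vg].
have /choice [vm vmP] := cq1; have /choice [vp vpP] := cq2.
pose p i := suppf (mink_add (subf i) (ys i)).
pose q i := suppf (mink_negsub (xs i) (supf i)).
pose s j := suppf (mink_add (subg j) (zs j)).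
have psub i : sublinear (p i).
  have [[_ [cs [cS [ns [nS _]]]]] _] := fqd i; have [_ ysup] := fsel i.
  by apply: suppf_mink_add_sublinear => //; apply: cS.1.
have qsub i : sublinear (q i).
  have [[_ [cs [cS [ns [nS _]]]]] _] := fqd i; have [xsub _] := fsel i.
  by apply: suppf_mink_negsub_sublinear => //; apply: cs.1.
have ssub j : Jx j -> sublinear (s j).
  move=> Jj; have [[_ [cs [cS [ns [nS _]]]]] _] := gqd j Jj.
  by apply: suppf_mink_add_sublinear => //; apply: cS.1; exact: gsel.
have sublin_le0 h (a : R) : sublinear h -> 0 <= a -> h v <= 0 -> h v0 <= 0 -> h (v + a *: v0) <= 0.
  move=> [hD hZ] a0 hv hv0; have := hD v (a *: v0); have := hZ a v0 a0.
  have : a * h v0 <= 0 by rewrite mulr_ge0_le0.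
  by move: hv; lra.
apply: contingent_of_eps => eps eps0.
(* Half of [eps] is spent on the distance from [v] to [u], the other half on that from [u] to [h c];
   the added 1 keeps the denominator positive. *)
pose t := eps / 2 / (`|v0| + 1).
have v01 : 0 < `|v0| + 1 by rewrite ltr_wpDl.
have t0 : 0 < t by rewrite !divr_gt0.
have tv0 : `|t *: v0| < eps / 2.
  rewrite normrZ gtr0_norm // /t mulrAC ltr_pdivrMr // ltr_pM2l ?divr_gt0 //.
  by rewrite ltrDl.
pose u := v + t *: v0.
have pu i : p i u <= 0 by apply: sublin_le0; rewrite ?(vf i).1 ?(v0f i).1 ?ltW.
have qu i : q i u <= 0 by apply: sublin_le0; rewrite ?(vf i).2 ?(v0f i).2 ?ltW.
have su j : Jx j -> s j u < 0.
  move=> Jj; have [sD sZ] := ssub j Jj; have := sD v (t *: v0); have := sZ t v0 (ltW t0).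
  have : t * s j v0 < 0 by rewrite pmulr_rlt0 // v0g.
  by move: (vg j Jj); rewrite -/(s j) -/u; lra.
pose h := affine_family u (orthant_dir vm vp) (@orthant_coef R m).
have tc (k : 'I_(m + m)) : continuous (fun c : 'rV[R]_m => orthant_coef c k) by exact: orthant_coef_continuous.
have h0 : h 0 = u.
  rewrite /h /affine_family big1 ?addr0 // => k _; rewrite /orthant_coef /orthant_dir.
  by case: (fintype.split k) => i; rewrite mxE ?oppr0 maxxx scale0r.
have hcont : continuous h by exact: affine_family_continuous.
have fdir i (c : 'rV[R]_m) : dir_deriv_is (f i) xb (h c) (qd_deriv (subf i) (supf i) (h c)).
  by have [[_ [_ [_ [_ [_ H]]]]] _] := fqd i; exact: H.
(* For [k != i], condition (1) at [k] bounds [p i] on [vm k], and condition (2) at [k] bounds it on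
   [vp k]. *)
have flo i (c : 'rV[R]_m) : c ord0 i < 0 -> qd_deriv (subf i) (supf i) (h c) < 0.
  move=> ci; have [qdi _] := fqd i; have [_ ysup] := fsel i.
  apply: le_lt_trans (qd_deriv_le _ qdi ysup) _.
  apply: sublinear_orthant_lo (psub i) (pu i) (vmP i).1 _ ci => k ki.
  by split; [have [] := (vmP k).2 i; rewrite 1?eq_sym | have [] := (vpP k).2 i; rewrite 1?eq_sym].
have fhi i (c : 'rV[R]_m) : 0 < c ord0 i -> 0 < qd_deriv (subf i) (supf i) (h c).
  move=> ci; have [qdi _] := fqd i; have [xsub _] := fsel i.
  apply: lt_le_trans (qd_deriv_ge _ qdi xsub); rewrite oppr_gt0.
  apply: sublinear_orthant_hi (qsub i) (qu i) (vpP i).1 _ ci => k ki.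
  by split; [have [] := (vmP k).2 i; rewrite 1?eq_sym | have [] := (vpP k).2 i; rewrite 1?eq_sym].
(* An active constraint decreases strictly along [h 0 = u], which persists for nearby [c]; an
   inactive one stays negative by upper semicontinuity with tolerance [- g j xb]. *)
have gnear j : \forall c \near (0 : 'rV[R]_m) & a \near 0^'+, g j (xb + a *: h c) <= 0.
  have [Jj|nJj] := pselect (Jx j).
    have [qdj uj] := gqd j Jj.
    have gneg : qd_deriv (subg j) (supg j) (h 0) < 0.
      by apply: le_lt_trans (qd_deriv_le _ qdj (gsel j Jj)) _; rewrite h0 su.
    have gd : dir_deriv_is (g j) xb (h 0) (qd_deriv (subg j) (supg j) (h 0)).
      by have [_ [_ [_ [_ [_ H]]]]] := qdj; exact: H.
    apply: filterS (near_neg tc uj gneg gd) => -[c a] /=.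
    by rewrite (_ : g j xb = 0) // => /ltW.
  have gj : 0 < - g j xb.
    by rewrite oppr_gt0 lt_neqAle gxb andbT; apply/eqP.
  apply: filterS (near_affine_family u (orthant_dir vm vp) tc 0 (gusc j nJj _ gj)) => -[c a] /=.
  by rewrite subrr => /ltW.
have [r r0 rP] : exists2 r, 0 < r & \forall a \near 0^'+, forall c, cube r c ->
    `|u - h c| < eps / 2 /\ forall j, g j (xb + a *: h c) <= 0.
  have hnear : \forall c \near (0 : 'rV[R]_m) & a \near (0 : R)^'+, `|u - h c| < eps / 2.
    near=> c a => /=; rewrite -h0; near: c.
    by have /cvgrPdist_lt := hcont 0; apply; rewrite divr_gt0.
  apply: (@near_cube _ _ (fun c a => `|u - h c| < eps / 2 /\ forall j, g j (xb + a *: h c) <= 0)).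
  have gall : \forall c \near (0 : 'rV[R]_m) & a \near (0 : R)^'+, forall j, g j (xb + a *: h c) <= 0.
    have FF : Filter (filter_prod (nbhs (0 : 'rV[R]_m)) (0 : R)^'+) by exact: filter_prod_filter.
    exact: (@filter_forall _ _ (fun j (ca : 'rV[R]_m * R) => g j (xb + ca.2 *: h ca.1) <= 0) _ FF gnear).
  apply: filterS (filterI hnear gall) => -[c a] /= [h1 h2]; by split.
have lo : \forall a \near 0^'+, forall i c, cube r c -> c ord0 i = - r -> f i (xb + a *: h c) < 0.
  apply: filter_forall => i; apply: (@cube_near_face _ _ _ _ _ (fun a c => f i (xb + a *: h c) < 0)) => c _ ci.
  have ci0 : c ord0 i < 0 by rewrite ci oppr_lt0.
  apply: filterS (near_neg tc (fqd i).2 (flo i c ci0) (fdir i c)) => -[c' a] /=.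
  by rewrite fxb.
have hi : \forall a \near 0^'+, forall i c, cube r c -> c ord0 i = r -> 0 < f i (xb + a *: h c).
  apply: filter_forall => i; apply: (@cube_near_face _ _ _ _ _ (fun a c => 0 < f i (xb + a *: h c))) => c _ ci.
  have ci0 : 0 < c ord0 i by rewrite ci.
  apply: filterS (near_pos tc (fqd i).2 (fhi i c ci0) (fdir i c)) => -[c' a] /=.
  by rewrite fxb.
(* For small [a] all points [xb + a *: h c] lie where every [f i] is continuous, uniformly over the
   compact cube. *)
have ct : \forall a \near 0^'+, forall i c, cube r c -> {for xb + a *: h c, continuous (f i)}.
  have /compact_near_coveringP cov := @cube_compact R m r.
  apply: filter_forall => i; apply: cov => c _.
  exact: (near_affine_family u (orthant_dir vm vp) tc c (fcont i)).
have [a [[a0 aeps] [aP [alo [ahi act]]]]] : exists a : R, (0 < a /\ a < eps) /\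
   (forall c, cube r c -> `|u - h c| < eps / 2 /\ forall j, g j (xb + a *: h c) <= 0) /\
   (forall i c, cube r c -> c ord0 i = - r -> f i (xb + a *: h c) < 0) /\
   (forall i c, cube r c -> c ord0 i = r -> 0 < f i (xb + a *: h c)) /\
   (forall i c, cube r c -> {for xb + a *: h c, continuous (f i)}).
  apply: (@filter_ex _ (0^'+ : set_system R)); apply: filterI.
    by apply: filterI; [exact: nbhs_right_gt|exact: nbhs_right_lt].
  by do 3![apply: filterI => //].
(* With [a] now fixed, the root in [c] solves all the equality constraints at once. *)
have [||||c cK cf] := @poincare_miranda R m r (fun i c => f i (xb + a *: h c)) => //.
  move=> i c cK; apply: (@continuous_comp _ _ _ (fun c => xb + a *: h c) (f i)); last exact: act.
  apply: (@cvgD _ _ _ (nbhs c) _ (fun=> xb) (fun c => a *: h c)); first exact: cvg_cst.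
  by apply: cvgZl_tmp; exact: hcont.
have [uh gh] := aP c cK.
exists a, (h c); split => //.
have -> : v - h c = (u - h c) - t *: v0 by rewrite /u addrAC addrK.
by apply: le_lt_trans (ler_normB _ _) _; rewrite [eps]splitr ltrD.
Unshelve. all: by end_near.
Qed.
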